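(* If $s$ is a natural number, then its successor $s\cup\{s\}$ is a natural number.
   Context: We work in the following first-order theory with one binary relation $\in$; all objects are called sets. Definitions: $s$ is an individual if $s\in s$. $s=t$ means $\forall u(u\in s\leftrightarrow u\in t)$. Axioms: (equality) $\forall s\forall t(s=t\rightarrow\forall u(s\in u\leftrightarrow t\in u))$; (individuals) $\forall s(s\in s\rightarrow\forall u(u\in s\rightarrow u=s))$; (pairs) $\forall s\forall t\exists v\forall u(u\in v\leftrightarrow(u=s\vee u=t))$, $v$ denoted $\{s,t\}$, and $\{s\}=\{s,s\}$; (regularity) $\forall s\exists v\,[(v\in s\wedge v\in v\wedge\forall u(u\in s\rightarrow u\in u))\vee(v\in s\wedge v\notin v\wedge\forall u(u\in v\wedge u\notin u\rightarrow u\notin s))]$; (union) $\forall s\exists v\forall u(u\in v\leftrightarrow\exists w(w\in s\wedge u\in w))$, $v$ denoted $\bigcup s$, and $s\cup t=\bigcup\{s,t\}$; (power) $\forall s\exists v\forall u(u\in v\leftrightarrow\forall w(w\in u\rightarrow w\in s))$; (separation) for every formula $\Phi(u)$ with $u$ free: $\forall s(\exists u(u\in s\wedge\Phi(u))\rightarrow\exists v\forall u(u\in v\leftrightarrow u\in s\wedge\Phi(u)))$. (In particular every set has a member; there is no empty set.) $s\subseteq t$ means $\forall u(u\in s\rightarrow u\in t)$. $s$ is transitive if $\forall u(u\in s\rightarrow u\subseteq s)$; in the phrase ''transitive set'' the set is not an individual, whereas ''transitive members'' may be individuals. A pair of different individuals $o\neq e$ is fixed and $0=\{o,e\}$. $s$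 is a natural number if $s$ is a transitive set with transitive members and $s\notin 0\wedge\forall u(u\in s\cup\{s\}\rightarrow u\in 0\cup\{0\}\vee\bigcup u\in u)$. *)

(* Defs.v *)
From Stdlib Require Import ClassicalEpsilon.

(* First-order formulas over the single binary relation symbol "in", with de
   Bruijn variables. There is no equality symbol: equality of sets is the
   defined relation [eqs] below. *)
Inductive formula : Type :=
| fMem : nat -> nat -> formula
| fBot : formula
| fAnd : formula -> formula -> formula
| fOr : formula -> formula -> formula
| fImp : formula -> formula -> formula
| fAll : formula -> formula
| fEx : formula -> formula.

Definition scons {A : Type} (x : A) (rho : nat -> A) (n : nat) : A :=
  match n with O => x | S k => rho k end.

Fixpoint holds {A : Type} (mem : A -> A -> Prop) (rho : nat -> A)
    (phi : formula) : Prop :=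
  match phi with
  | fMem i j => mem (rho i) (rho j)
  | fBot => False
  | fAnd p q => holds mem rho p /\ holds mem rho q
  | fOr p q => holds mem rho p \/ holds mem rho q
  | fImp p q => holds mem rho p -> holds mem rho q
  | fAll p => forall x, holds mem (scons x rho) p
  | fEx p => exists x, holds mem (scons x rho) p
  end.

Definition ext_eq {A : Type} (mem : A -> A -> Prop) (s t : A) : Prop :=
  forall u, mem u s <-> mem u t.

Record model : Type := Model {
  carrier :> Type;
  mem : carrier -> carrier -> Prop;
  ax_equality : forall s t,
    ext_eq mem s t -> forall u, mem s u <-> mem t u;
  ax_individuals : forall s,
    mem s s -> forall u, mem u s -> ext_eq mem u s;
  ax_pairs : forall s t, exists v, forall u,
    mem u v <-> (ext_eq mem u s \/ ext_eq mem u t);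
  ax_regularity : forall s, exists v,
    (mem v s /\ mem v v /\ (forall u, mem u s -> mem u u)) \/
    (mem v s /\ ~ mem v v /\ (forall u, mem u v /\ ~ mem u u -> ~ mem u s));
  ax_union : forall s, exists v, forall u,
    mem u v <-> (exists w, mem w s /\ mem u w);
  ax_power : forall s, exists v, forall u,
    mem u v <-> (forall w, mem w u -> mem w s);
  (* Variable 0 of [phi] is the distinguished free variable u; the other free
     variables are parameters, valued by [rho]. *)
  ax_separation : forall (phi : formula) (rho : nat -> carrier) s,
    (exists u, mem u s /\ holds mem (scons u rho) phi) ->
    exists v, forall u, mem u v <-> (mem u s /\ holds mem (scons u rho) phi)
}.

Arguments mem {m} _ _.

Declare Scope sets_scope.
Delimit Scope sets_scope with sets.
Open Scope sets_scope.

Notation "s ∈ t" := (mem s t) (at level 70) : sets_scope.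
Notation "s ∉ t" := (~ mem s t) (at level 70) : sets_scope.

Definition eqs {M : model} (s t : M) : Prop := ext_eq mem s t.
Notation "s ≡ t" := (eqs s t) (at level 70) : sets_scope.

Definition subset {M : model} (s t : M) : Prop := forall u, u ∈ s -> u ∈ t.
Notation "s ⊆ t" := (subset s t) (at level 70) : sets_scope.

(* The axioms determine {s, t} and the union of s only up to [≡]; these
   operations select a representative. *)
Definition pair {M : model} (s t : M) : M :=
  proj1_sig (constructive_indefinite_description _ (ax_pairs M s t)).

Definition bigcup {M : model} (s : M) : M :=
  proj1_sig (constructive_indefinite_description _ (ax_union M s)).
Notation "⋃ s" := (bigcup s) (at level 35, right associativity) : sets_scope.

Definition singleton {M : model} (s : M) : M := pair s s.

Definition cup {M : model} (s t : M) : M := ⋃ (pair s t).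
Notation "s ∪ t" := (cup s t) (at level 50, left associativity) : sets_scope.

Definition individual {M : model} (s : M) : Prop := s ∈ s.

Definition transitive {M : model} (s : M) : Prop := forall u, u ∈ s -> u ⊆ s.

(* The members, unlike s itself, are allowed to be individuals. *)
Definition transitive_set_with_transitive_members {M : model} (s : M) : Prop :=
  ~ individual s /\ transitive s /\ (forall u, u ∈ s -> transitive u).

Definition zero {M : model} (o e : M) : M := pair o e.

Definition natural_number {M : model} (o e s : M) : Prop :=
  transitive_set_with_transitive_members s /\
  s ∉ zero o e /\
  (forall u, u ∈ s ∪ singleton s ->
     u ∈ zero o e ∪ singleton (zero o e) \/ ⋃ u ∈ u).

Definition successor {M : model} (s : M) : M := s ∪ singleton s.

(* Main.v *)
(* Writing t for the successor of s, transitivity of s gives that the union of t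
   is s itself, which is a member of t.  So t satisfies the last clause in the
   definition of a natural number, and the members of t satisfy it because s is
   a natural number. *)

Require Import Defs.

Section Sets.

Context {M : model}.
Implicit Types s t u w x : M.

(** Since [≡] compares members only, rewriting to the right of [∈] is immediate, but rewriting to
    the left needs the equality axiom. *)
Lemma mem_eqs s t u : s ≡ t -> s ∈ u -> t ∈ u.
Proof. intros E H. now apply (ax_equality M s t E u). Qed.

Lemma mem_pair s t u : u ∈ pair s t <-> u ≡ s \/ u ≡ t.
Proof.
  unfold pair. destruct (ClassicalEpsilon.constructive_indefinite_description _ _) as [v Hv].
  apply Hv.
Qed.

Lemma mem_bigcup s u : u ∈ ⋃ s <-> exists w, w ∈ s /\ u ∈ w.
Proof.
  unfold bigcup. destruct (ClassicalEpsilon.constructive_indefinite_description _ _) as [v Hv].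
  apply Hv.
Qed.

Lemma mem_cup s t u : u ∈ s ∪ t <-> u ∈ s \/ u ∈ t.
Proof.
  unfold cup. rewrite mem_bigcup. split.
  - intros (w & Hw & Hu). apply mem_pair in Hw as [E | E]; apply E in Hu; tauto.
  - intros [H | H]; [exists s | exists t]; (split; [apply mem_pair | exact H]);
      [left | right]; intro; reflexivity.
Qed.

Lemma mem_successor s u : u ∈ successor s <-> u ∈ s \/ u ≡ s.
Proof.
  unfold successor, singleton. rewrite mem_cup, mem_pair. tauto.
Qed.

Lemma self_mem_successor s : s ∈ successor s.
Proof. apply mem_successor. right. intro. reflexivity. Qed.

Lemma individual_eqs s t : s ≡ t -> individual s -> individual t.
Proof. intros E H. apply (mem_eqs s t t E). now apply E. Qed.

Lemma transitive_eqs s t : s ≡ t -> transitive s -> transitive t.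
Proof. intros E H u Hu x Hx. apply E. apply (H u); [now apply E | exact Hx]. Qed.

(** The member [s] contributes all of [s], and by transitivity every other member adds nothing new.
    [u] is taken up to [≡] because membership in a successor identifies its top element only that
    far. *)
Lemma bigcup_successor s u :
  transitive s -> u ≡ successor s -> s ≡ ⋃ u.
Proof.
  intros Ht E x. rewrite mem_bigcup. split.
  - intro Hx. exists s. split; [apply E, self_mem_successor | exact Hx].
  - intros (w & Hw & Hx). apply E, mem_successor in Hw as [Hw | Ew].
    + exact (Ht w Hw x Hx).
    + now apply Ew.
Qed.

(** Both ways for the successor to lie in itself force [s ∈ s]: if it is a member of [s],
    transitivity passes its member [s] down; if it is [≡ s], then [s] is its own member. *)
Lemma successor_not_individual s :
  ~ individual s -> transitive s -> ~ individual (successor s).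
Proof.
  intros Hs Ht H. apply Hs. apply mem_successor in H as [H | E].
  - exact (Ht _ H s (self_mem_successor s)).
  - apply E, self_mem_successor.
Qed.

Lemma transitive_successor s : transitive s -> transitive (successor s).
Proof.
  intros Ht u Hu x Hx. apply mem_successor. left.
  apply mem_successor in Hu as [Hu | E].
  - exact (Ht u Hu x Hx).
  - now apply E.
Qed.

End Sets.

Theorem theorem3 (M : model) (o e : M)
    (ho : individual o) (he : individual e) (hoe : ~ o ≡ e) (s : M) :
  natural_number o e s -> natural_number o e (successor s).
Proof.
  intros ((Hi & Ht & Hm) & _ & Hn).
  pose proof (successor_not_individual s Hi Ht) as Hsi.
  split; [split; [exact Hsi | split] | split].
  - now apply transitive_successor.
  - intros u Hu. apply mem_successor in Hu as [Hu | E].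
    + now apply Hm.
    + apply (transitive_eqs s); [| exact Ht]. intro x. symmetry. apply E.
  (* Members of [zero o e] are [≡ o] or [≡ e], hence individuals, which the successor is not. *)
  - intro H. apply Hsi. apply mem_pair in H as [E | E].
    + apply (individual_eqs o); [| exact ho]. intro x. symmetry. apply E.
    + apply (individual_eqs e); [| exact he]. intro x. symmetry. apply E.
  - intros u Hu. apply (mem_successor (successor s)) in Hu as [Hu | E].
    (* [successor s] unfolds to [s ∪ singleton s], exactly the range of the clause [Hn] for [s]. *)
    + now apply Hn.
    + right. apply (mem_eqs s).
      * now apply bigcup_successor.
      * apply E, self_mem_successor.
Qed.
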